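(* Any two $\omega$-Cantor spaces are homeomorphic.
   Context: If $C\subsetneq D$ are Cantor spaces, $C$ is entwined in $D$ if $C$ has empty interior in $D$. An $\omega$-Cantor space is a topological space of the form $\varinjlim_{i\in\mathbb N}X_i$ (direct limit topology), where each $X_i$ is a Cantor space, $X_i\subset X_{i+1}$ (as a subspace), and each $X_i$ is entwined in $X_{i+1}$. *)

(* Defs.v *)
From mathcomp Require Import all_boot.
From mathcomp Require Import all_classical topology cantor.

Set Implicit Arguments.
Unset Strict Implicit.
Unset Printing Implicit Defensive.

Local Open Scope classical_set_scope.

Definition homeomorphic (X Y : topologicalType) : Prop :=
  exists (f : X -> Y) (g : Y -> X),
    [/\ continuous f, continuous g, cancel f g & cancel g f].

(* The predicate [cantor_like] of MathComp-Analysis does not include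
   metrizability, so it is not a definition of Cantor spaces. *)
Definition is_cantor_space (X : topologicalType) : Prop :=
  homeomorphic X cantor_space.

(* [f] identifies [X] with the subspace [range f] of [Y]. *)
Definition topological_embedding (X Y : topologicalType) (f : X -> Y) : Prop :=
  injective f /\
  forall A : set X, open A <-> exists2 B : set Y, open B & f @^-1` B = A.

(* [C] is a proper subset of [D], with empty interior in [D]. *)
Definition entwined (D : topologicalType) (C : set D) : Prop :=
  C `<` [set: D] /\ interior C = set0.

(* For injective bonding maps [f], the maps [g] exhibit [Y] as the direct limit
   of the [X i]: [Y] is the increasing union of copies of the [X i], with the
   finest topology for which all the inclusions [g i] are continuous. *)
Definition is_direct_limit (X : nat -> topologicalType)
    (f : forall i, X i -> X i.+1) (Y : topologicalType)
    (g : forall i, X i -> Y) : Prop :=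
  [/\ forall i (x : X i), g i.+1 (f i x) = g i x,
      forall i, injective (g i),
      \bigcup_i range (g i) = [set: Y] &
      forall A : set Y, open A <-> forall i, open (g i @^-1` A)].

(* The inclusion of [X i] in [X i.+1] as a subspace is the embedding [f i]. *)
Definition is_omega_cantor_space (Y : topologicalType) : Prop :=
  exists (X : nat -> topologicalType) (f : forall i, X i -> X i.+1)
         (g : forall i, X i -> Y),
    [/\ forall i, is_cantor_space (X i),
        forall i, topological_embedding (f i),
        forall i, entwined (range (f i)) &
        is_direct_limit f g].

(* Main.v *)
(* It suffices to extend homeomorphisms step by step along the two towers: if a
   compact S embeds by e and e' into Cantor spaces with nowhere dense images,
   then some homeomorphism h satisfies h o e = e'.  This is a back-and-forth: one
   builds finite clopen partitions, finer and finer, of the two spaces, matched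
   piece by piece, such that matched pieces have the same trace on S.  To split
   a piece as prescribed by its partner, separate the two prescribed traces on S
   by a clopen set; nowhere density provides, in the piece, two further points
   off S which keep both halves nonempty even when a trace is empty. *)
Require Import Defs.
From mathcomp Require Import all_boot.
From mathcomp Require Import all_classical topology.
From mathcomp Require Import cantor.

Set Implicit Arguments.
Unset Strict Implicit.
Unset Printing Implicit Defensive.

Local Open Scope classical_set_scope.

(** * Compactness and clopen separation *)

(** The [C n] form a base of a proper filter; a cluster point of this filter lies in each closed set
    [C n]. *)
Lemma compact_nested_nonempty (X : topologicalType) (C : nat -> set X) :
  compact [set: X] -> (forall n, closed (C n)) -> (forall n, C n !=set0) ->
  (forall n, C n.+1 `<=` C n) -> \bigcap_n C n !=set0.
Proof.
move=> cptX clC C0 subC.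
have decC m n : m <= n -> C n `<=` C m.
  elim: n => [|n IH]; first by rewrite leqn0 => /eqP ->.
  by rewrite leq_eqVlt => /predU1P[->//|/IH]; apply: subset_trans.
have FF : ProperFilter (filter_from [set: nat] C).
  apply: filter_from_proper => [|n _]; last exact: C0.
  apply: filter_from_filter => [|m n _ _]; first by exists 0.
  exists (maxn m n) => //; rewrite subsetI.
  by split; apply: decC; rewrite ?leq_maxl ?leq_maxr.
have [x [_ clx]] := cptX _ FF filterT.
exists x => n _; have /closure_id -> := clC n.
by move: clx; rewrite clusterE; apply; exists n.
Qed.

(** If every clopen [D] containing [B] met [A], the traces of these [D] on [A] would generate a
    proper filter, clustering at some [a] in [A]. A clopen neighbourhood of [a] missing [B] has its
    complement among the [D], a contradiction. *)
Lemma compact_clopen_separation (X : topologicalType) (A B : set X) :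
  hausdorff_space X -> zero_dimensional X -> compact [set: X] ->
  compact A -> compact B -> A `&` B = set0 ->
  exists D, [/\ clopen D, B `<=` D & D `&` A = set0].
Proof.
move=> hX zX cX cA cB AB0; apply: contrapT => noD.
pose F := filter_from [set D : set X | clopen D /\ B `<=` D] (fun D => D `&` A).
have FF : ProperFilter F.
  apply: filter_from_proper; last first.
    move=> D [clD BD]; apply/set0P/eqP => DA0.
    by apply: noD; exists D.
  apply: filter_from_filter; first by exists setT; split => //; exact: clopenT.
  move=> D E [clD BD] [clE BE]; exists (D `&` E).
    by split; [exact: clopenI|move=> x Bx; split; [exact: BD|exact: BE]].
  by move=> x [[Dx Ex] Ax].
have FA : F A.
  exists setT; first by split=> //; exact: clopenT.
  by move=> x [].
have [a [Aa cla]] := cA F FF FA.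
have nBa : ~ B a by move=> Ba; have : set0 a by rewrite -AB0.
have oB : open (~` B) by apply: closed_openC; exact: compact_closed.
have /zero_dimensional_cvg : nbhs a (~` B) by apply: open_nbhs_nbhs; split.
move=> /(_ hX zX cX)[D [Da clD] DB].
have FD : F (~` D).
  exists (~` D); last by move=> x [].
  by split; [exact: clopenC|move=> x Bx /DB].
have nD : nbhs a D by apply: open_nbhs_nbhs; split=> //; case: clD.
by have [x []] := cla _ _ FD nD.
Qed.

(** * Locally constant maps as clopen partitions *)

(** This is continuity for the discrete topology on [T]; on a compact space, the fibers of such a
    map form a finite clopen partition. *)
Definition locally_constant (X : topologicalType) (T : Type) (p : X -> T) :=
  forall x, \forall y \near x, p y = p x.

Lemma locally_constant_cst (X : topologicalType) (T : Type) (t : T) :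
  locally_constant (fun _ : X => t).
Proof. by move=> x; exact: nearW. Qed.

Lemma locally_constant2 (X : topologicalType) (T U V : Type) (op : T -> U -> V)
    (p : X -> T) (q : X -> U) :
  locally_constant p -> locally_constant q ->
  locally_constant (fun x => op (p x) (q x)).
Proof.
by move=> lp lq x; apply: filterS2 (lp x) (lq x) => y -> ->.
Qed.

Lemma locally_constant_comp (X Y : topologicalType) (T : Type)
    (f : X -> Y) (p : Y -> T) :
  continuous f -> locally_constant p -> locally_constant (p \o f).
Proof. by move=> cf lp x; exact: cf (lp (f x)). Qed.

Lemma locally_constant_clopen (X : topologicalType) (T : Type) (p : X -> T)
    (A : set T) :
  locally_constant p -> clopen (p @^-1` A).
Proof.
move=> lp; have op B : open (p @^-1` B).
  by rewrite openE => x Bx; apply: filterS (lp x) => y /= ->.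
by split; [exact: op|rewrite -openC preimage_setC; exact: op].
Qed.

Lemma clopen_locally_constant (X : topologicalType) (D : set X) :
  clopen D -> locally_constant (fun x => `[< D x >]).
Proof.
move=> [oD cD] x; have [Dx|nDx] := pselect (D x).
  have : nbhs x D by exact: open_nbhs_nbhs.
  by apply: filterS => y Dy; rewrite !asboolT.
have : nbhs x (~` D) by apply: open_nbhs_nbhs; split=> //; exact: closed_openC.
by apply: filterS => y Dy; rewrite !asboolF.
Qed.

Lemma cantor_coord_locally_constant n :
  locally_constant (fun x : cantor_space => x n).
Proof.
move=> x; have /(_ x) := @proj_continuous nat (fun=> bool) n.
by move=> /discrete_cvg; apply.
Qed.

Lemma continuous_to_cantor (X : topologicalType) (f : X -> cantor_space) :
  (forall n, locally_constant (fun x => f x n)) -> continuous f.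
Proof.
move=> lf x; apply/cvg_sup => n A /= [_ [[B Bop <-] Bfx sBA]].
by apply: filterS (lf n x) => y /= yx; apply: sBA; rewrite /= yx.
Qed.

(** * Matched partitions and the back-and-forth *)

(* The fibers of p and q are the matched pieces of the two partitions, and T is
   the type of their labels. *)
Record matched (S X Y : topologicalType) (T : Type) (e : S -> X) (e' : S -> Y)
    (p : X -> T) (q : Y -> T) : Prop := Matched {
  matched_lcl : locally_constant p;
  matched_lcr : locally_constant q;
  matched_rangel : forall x, exists y, q y = p x;
  matched_ranger : forall y, exists x, p x = q y;
  matched_comm : forall s, p (e s) = q (e' s) }.

Lemma matched_sym (S X Y : topologicalType) (T : Type) (e : S -> X)
    (e' : S -> Y) (p : X -> T) (q : Y -> T) :
  matched e e' p q -> matched e' e q p.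
Proof. by case=> *; split. Qed.

(** This transfers the cut of one piece by [a] to its partner. The last clause ensures that the
    refined labels occurring on the two sides are again the same. *)
Lemma fiber_coordinate (S X Y : topologicalType) (T : Type)
    (e : S -> X) (e' : S -> Y) (p : X -> T) (q : Y -> T) (a : X -> bool) (t : T) :
  cantor_like Y -> compact [set: S] -> continuous e ->
  continuous e' -> injective e' -> interior (range e') = set0 ->
  matched e e' p q -> locally_constant a ->
  exists b : Y -> bool, [/\ locally_constant b,
    forall s, p (e s) = t -> b (e' s) = a (e s) &
    forall c, (exists2 x, p x = t & a x = c) <-> (exists2 y, q y = t & b y = c)].
Proof.
move=> [pfY cY hY zY] cS ce ce' ie' e'0 [lp lq pq qp pqe] la.
(* If a is constant on the fiber of p over t, then b must be constant on the
   fiber of q; otherwise b must take both values there. *)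
have [both|nboth] := pselect (forall c, exists2 x, p x = t & a x = c); last first.
  have [c ac] : exists c, forall x, p x = t -> a x = c.
    apply: contrapT => nc; apply: nboth => c; apply: contrapT => nx.
    apply: nc; exists (~~ c) => x px.
    have : a x <> c by move=> ax; apply: nx; exists x.
    by case: (a x) (c) => [] [].
  exists (fun=> c); split; first exact: locally_constant_cst.
    by move=> s /ac.
  move=> d; split => [[x px <-]|[y qy <-]].
    by have [y qy] := pq x; exists y; rewrite ?qy ?(ac x).
  by have [x px] := qp y; exists x; rewrite ?ac ?px.
have [x0 px0 _] := both false; have [y qy] := pq x0.
(* The fiber is open and nonempty, so it cannot lie in [range e']; perfectness then gives two
   distinct points of [U]. *)
pose U := q @^-1` [set t] `&` ~` range e'.
have ce'S : closed (range e').
  apply: compact_closed => //; apply: continuous_compact => //.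
  exact: continuous_subspaceT.
have oq : open (q @^-1` [set t]) by case: (locally_constant_clopen [set t] lq).
have oU : open U by apply: openI => //; exact: closed_openC.
have U0 : U !=set0.
  apply/set0P/eqP => U0; suff : interior (range e') y by rewrite e'0.
  rewrite /interior nbhsE; exists (q @^-1` [set t]).
    by split=> //=; rewrite qy.
  by move=> z qz; apply: contrapT => nz; have : set0 z by rewrite -U0.
have [y0 [y1 [Uy0 Uy1 y01]]] := (iffLR perfectTP_ex) pfY U oU U0.
(* [E c] collects the points of [S] where the value [c] is prescribed, inside the fiber or not, and
   one point off [S] that makes [b] take the value [c] in the fiber. *)
pose E c := e' @` [set s | a (e s) = c] `|` [set if c then y1 else y0].
have cE c : compact (E c).
  apply: compactU; last exact: compact_set1.
  apply: continuous_compact; first exact: continuous_subspaceT.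
  apply: subclosed_compact cS _ => //.
  have [] // := @locally_constant_clopen S bool (a \o e) [set c].
  exact: locally_constant_comp.
have E01 : E false `&` E true = set0.
  rewrite -subset0 => z [[[s0 a0 <-]|->] [[s1 a1]|]].
  - by move=> /ie' s10; move: a1; rewrite /= s10 a0.
  - by move=> /= ey; case: Uy1 => _; apply; exists s0.
  - by move=> /= ey; case: Uy0 => _; apply; exists s1.
  - by move=> /eqP; rewrite (negPf y01).
have [D [clD ED DE]] := compact_clopen_separation hY zY cY (cE _) (cE _) E01.
have bE c z : E c z -> `[< D z >] = c.
  case: c => Ez; first by rewrite asboolT//; exact: ED.
  by rewrite asboolF// => Dz; have : set0 z by rewrite -DE.
exists (fun z => `[< D z >]); split; first exact: clopen_locally_constant.
  by move=> s _; apply: bE; left; exists s.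
move=> c; split=> _; last exact: both.
exists (if c then y1 else y0); first by case: (c); [case: Uy1|case: Uy0].
by apply: bE; right.
Qed.

Lemma lift_coordinate (S X Y : topologicalType)
    (e : S -> X) (e' : S -> Y) (p : X -> seq bool) (q : Y -> seq bool)
    (a : X -> bool) :
  cantor_like Y -> compact [set: S] -> continuous e ->
  continuous e' -> injective e' -> interior (range e') = set0 ->
  matched e e' p q -> locally_constant a ->
  exists b : Y -> bool,
    matched e e' (fun x => a x :: p x) (fun y => b y :: q y).
Proof.
move=> kY cS ce ce' ie' e'0 pq la.
have [b bP] := choice (fun t =>
  fiber_coordinate t kY cS ce ce' ie' e'0 pq la).
(* The maps obtained on the separate fibers are glued; near any point [q] is constant, so only one
   of them matters. *)
exists (fun y => b (q y) y); split.
- exact: locally_constant2 la (matched_lcl pq).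
- apply: locally_constant2 (matched_lcr pq) => y.
  have [lb _ _] := bP (q y).
  by apply: filterS2 (matched_lcr pq y) (lb y) => z -> ->.
- move=> x; have [_ _ /(_ (a x))[+ _]] := bP (p x).
  by case=> [|y qy by_]; [exists x|exists y; rewrite qy by_].
- move=> y; have [_ _ /(_ (b (q y) y))[_ +]] := bP (q y).
  by case=> [|x px ax]; [exists y|exists x; rewrite px ax].
- move=> s; have [_ bs _] := bP (p (e s)).
  by rewrite -(matched_comm pq) bs.
Qed.

Lemma cantor_extension (S : topologicalType) (e e' : S -> cantor_space) :
  compact [set: S] -> continuous e -> injective e ->
  interior (range e) = set0 ->
  continuous e' -> injective e' -> interior (range e') = set0 ->
  exists h h' : cantor_space -> cantor_space,
    [/\ continuous h, continuous h', cancel h h', cancel h' h &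
        forall s, h (e s) = e' s].
Proof.
move=> cS ce ie e0 ce' ie' e'0; pose K := cantor_space.
have kK := cantor_like_cantor_space.
pose D := ((K -> seq bool) * (K -> seq bool))%type.
(* Recording coordinate n on both sides makes the labels separate points. *)
pose ext n (ab : (K -> bool) * (K -> bool)) (d : D) : D :=
  (fun x => ab.1 x :: x n :: d.1 x, fun y => y n :: ab.2 y :: d.2 y).
have step nd : exists ab, matched e e' nd.2.1 nd.2.2 ->
    matched e e' (ext nd.1 ab nd.2).1 (ext nd.1 ab nd.2).2.
  case: nd => n [p q] /=.
  (* Unmatched pairs get an arbitrary value, so that [choice] applies to all of them. *)
  have [pq|?] := pselect (matched e e' p q); last by exists (fun=> true, fun=> true).
  have lcn := @cantor_coord_locally_constant n.
  (* Forth: coordinate [n] of the first space is copied to the second. Then back, with the roles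
     exchanged. *)
  have [b pqb] := lift_coordinate kK cS ce ce' ie' e'0 pq lcn.
  have [a pqa] := lift_coordinate kK cS ce' ce ie e0 (matched_sym pqb) lcn.
  by exists (a, b) => _; apply: matched_sym.
have [ab abP] := choice step.
pose d := fix d n : D :=
  if n is m.+1 then ext m (ab (m, d m)) (d m) else (fun=> [::], fun=> [::]).
pose p n := (d n).1; pose q n := (d n).2.
have pq n : matched e e' (p n) (q n).
  elim: n => [|n IH]; last exact: abP (n, d n) IH.
  by split=> //; [exact: locally_constant_cst|exact: locally_constant_cst|
    move=> x; exists x|move=> x; exists x].
(* The pieces of the second space labelled like [x] are closed, nonempty, and nested because each
   label extends the previous one. *)
have ptotal x : exists y, forall n, q n y = p n x.
  have [||||y Hy] := @compact_nested_nonempty K (fun n => q n @^-1` [set p n x]).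
  - by case: kK.
  - by move=> n; have [] := locally_constant_clopen [set p n x] (matched_lcr (pq n)).
  - by move=> n; exact: matched_rangel (pq n) x.
  - by move=> n y [].
  - by exists y => n; exact: Hy.
have qtotal y : exists x, forall n, p n x = q n y.
  have [||||x Hx] := @compact_nested_nonempty K (fun n => p n @^-1` [set q n y]).
  - by case: kK.
  - by move=> n; have [] := locally_constant_clopen [set q n y] (matched_lcl (pq n)).
  - by move=> n; exact: matched_ranger (pq n) y.
  - by move=> n x [].
  - by exists x => n; exact: Hx.
have pinj x x' : (forall n, p n x = p n x') -> x = x'.
  by move=> xx'; apply/funext => n; case: (xx' n.+1).
have qinj y y' : (forall n, q n y = q n y') -> y = y'.
  by move=> yy'; apply/funext => n; case: (yy' n.+1).
(* Hence the relation [forall n, p n x = q n y] is the graph of a bijection. *)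
have [h hP] := choice ptotal; have [h' h'P] := choice qtotal.
exists h, h'; split.
(* Coordinate [n] of [h x] is the head of the label of [x] at stage [n.+1], which is locally
   constant in [x]. *)
- apply: continuous_to_cantor => n x.
  have := matched_lcl (pq n.+1) x; apply: filterS => y pyx.
  by have := hP x n.+1; have := hP y n.+1; rewrite pyx => <- [].
- apply: continuous_to_cantor => n y.
  have := matched_lcr (pq n.+1) y; apply: filterS => x qyx.
  by have := h'P y n.+1; have := h'P x n.+1; rewrite qyx => <- [].
- by move=> x; apply: pinj => n; rewrite h'P hP.
- by move=> x; apply: qinj => n; rewrite hP h'P.
- by move=> s; apply: qinj => n; rewrite hP (matched_comm (pq n)).
Qed.

(** * Transport to arbitrary Cantor spaces *)

Definition mutual_homeo (X Y : topologicalType) (h : X -> Y) (h' : Y -> X) :=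
  [/\ continuous h, continuous h', cancel h h' & cancel h' h].

Lemma mutual_homeo_sym (X Y : topologicalType) (h : X -> Y) (h' : Y -> X) :
  mutual_homeo h h' -> mutual_homeo h' h.
Proof. by case. Qed.

Lemma mutual_homeo_comp (X Y Z : topologicalType) (h : X -> Y) (h' : Y -> X)
    (k : Y -> Z) (k' : Z -> Y) :
  mutual_homeo h h' -> mutual_homeo k k' -> mutual_homeo (k \o h) (h' \o k').
Proof.
move=> [ch ch' hK h'K] [ck ck' kK k'K]; split; last 2 first.
- exact: can_comp.
- exact: can_comp.
- by move=> x; apply: continuous_comp; [exact: ch|exact: ck].
- by move=> x; apply: continuous_comp; [exact: ck'|exact: ch'].
Qed.

(** By injectivity, [k] pulls a neighbourhood inside [range (k \o e)] back to one inside
    [range e]. *)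
Lemma interior_range_comp (S X Y : topologicalType) (e : S -> X) (k : X -> Y) :
  continuous k -> injective k -> interior (range e) = set0 ->
  interior (range (k \o e)) = set0.
Proof.
move=> ck ik e0; rewrite -subset0 => y ny.
have [s _ sy] := nbhs_singleton ny.
suff : interior (range e) (e s) by rewrite e0.
have : nbhs (e s) (k @^-1` range (k \o e)) by apply: ck; rewrite [k _]sy.
by apply: filterS => x [r _ /ik <-]; exists r.
Qed.

Lemma embedding_continuous (X Y : topologicalType) (f : X -> Y) :
  topological_embedding f -> continuous f.
Proof. by move=> [_ fP]; apply/continuousP => B oB; apply/fP; exists B. Qed.

Lemma cantor_space_extension (S X Y : topologicalType) (e : S -> X) (e' : S -> Y) :
  is_cantor_space X -> is_cantor_space Y -> compact [set: S] ->
  continuous e -> injective e -> interior (range e) = set0 ->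
  continuous e' -> injective e' -> interior (range e') = set0 ->
  exists h h', mutual_homeo h h' /\ forall s, h (e s) = e' s.
Proof.
move=> [k [k' [ck ck' kK k'K]]] [l [l' [cl cl' lK l'K]]] cS ce ie e0 ce' ie' e'0.
have [||||||h [h' [ch ch' hK h'K he]]] :=
  @cantor_extension S (k \o e) (l \o e') cS.
- by move=> x; apply: continuous_comp; [exact: ce|exact: ck].
- exact: inj_comp (can_inj kK) ie.
- exact: interior_range_comp ck (can_inj kK) e0.
- by move=> x; apply: continuous_comp; [exact: ce'|exact: cl].
- exact: inj_comp (can_inj lK) ie'.
- exact: interior_range_comp cl (can_inj lK) e'0.
exists (l' \o (h \o k)), ((k' \o h') \o l); split; last first.
  by move=> s; rewrite /= he /= lK.
by apply: (@mutual_homeo_comp _ cantor_space); [apply: mutual_homeo_comp|].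
Qed.

Lemma cantor_space_is_compact (X : topologicalType) :
  is_cantor_space X -> compact [set: X].
Proof.
move=> [k [k' [_ ck' kK _]]].
have -> : [set: X] = k' @` [set: cantor_space].
  by apply/seteqP; split=> // x _; exists (k x).
by apply: continuous_compact;
  [exact: continuous_subspaceT|exact: cantor_space_compact].
Qed.

(** * Towers and their direct limits *)

(** A point of [Y] is sent through any of its representatives; two representatives are compared at a
    common stage. Continuity is tested stage by stage, as openness in [Y] is. *)
Lemma direct_limit_map (X X' : nat -> topologicalType)
    (f : forall i, X i -> X i.+1) (f' : forall i, X' i -> X' i.+1)
    (Y Z : topologicalType) (g : forall i, X i -> Y) (g' : forall i, X' i -> Z)
    (h : forall i, X i -> X' i) :
  is_direct_limit f g -> is_direct_limit f' g' ->
  (forall i, continuous (h i)) ->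
  (forall i x, h i.+1 (f i x) = f' i (h i x)) ->
  exists2 H : Y -> Z, continuous H & forall i x, H (g i x) = g' i (h i x).
Proof.
move=> [gf ig gT gop] [g'f' _ _ g'op] ch hf.
have lift i j : i <= j ->
    forall x, exists2 y, g j y = g i x & g' j (h j y) = g' i (h i x).
  elim: j => [|j IH]; first by rewrite leqn0 => /eqP -> x; exists x.
  rewrite leq_eqVlt => /predU1P[-> x|/IH jx x]; first by exists x.
  have [y gy g'y] := jx x; exists (f j y); first by rewrite gf.
  by rewrite hf g'f'.
have compat i j x y : g i x = g j y -> g' i (h i x) = g' j (h j y).
  wlog ij : i j x y / i <= j => [wlg|].
    by have [/wlg|/ltnW /wlg wl /esym/wl ->] := leqP i j; first exact.
  by have [z gz <-] := lift i j ij x; rewrite -gz => /ig ->.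
have Hex y : exists z, forall i x, g i x = y -> g' i (h i x) = z.
  have : [set: Y] y by [].
  rewrite -gT => -[i _ [x _ <-]].
  by exists (g' i (h i x)) => j x'; apply: compat.
have [H HP] := choice Hex; exists H; last by move=> i x; rewrite (HP _ i x erefl).
apply/continuousP => A oA; apply/gop => i.
have -> : g i @^-1` (H @^-1` A) = h i @^-1` (g' i @^-1` A).
  by apply/funext => x; rewrite /= (HP _ i x erefl).
by move/continuousP: (ch i); apply; move/g'op: oA.
Qed.

Lemma cantor_towers_isomorphic (X X' : nat -> topologicalType)
    (f : forall i, X i -> X i.+1) (f' : forall i, X' i -> X' i.+1) :
  (forall i, is_cantor_space (X i)) -> (forall i, is_cantor_space (X' i)) ->
  (forall i, topological_embedding (f i)) ->
  (forall i, topological_embedding (f' i)) ->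
  (forall i, entwined (range (f i))) -> (forall i, entwined (range (f' i))) ->
  exists (h : forall i, X i -> X' i) (h' : forall i, X' i -> X i),
    (forall i, mutual_homeo (h i) (h' i)) /\
    (forall i x, h i.+1 (f i x) = f' i (h i x)).
Proof.
move=> kX kX' ef ef' nf nf'.
pose D i := ((X i -> X' i) * (X' i -> X i))%type.
have [d0 d0P] : exists d : D 0, mutual_homeo d.1 d.2.
  have [k [k' kP]] := kX 0; have [l [l' lP]] := kX' 0.
  exists (l' \o k, k' \o l).
  by apply: mutual_homeo_comp kP _; exact: mutual_homeo_sym.
(* The implication sits under the existential so that the recursion below needs no proof about [d];
   if [d] is not a homeomorphism, any pair of maps will do. *)
have step i (d : D i) : exists d' : D i.+1, mutual_homeo d.1 d.2 ->
    mutual_homeo d'.1 d'.2 /\ forall x, d'.1 (f i x) = f' i (d.1 x).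
  have [[ch ch' hK h'K]|] := pselect (mutual_homeo d.1 d.2); last first.
    have [k [k' _]] := kX i.+1; have [l [l' _]] := kX' i.+1.
    by exists (l' \o k, k' \o l).
  (* Here [S] is [X i], embedded in [X i.+1] by [f i] and in [X' i.+1] through the homeomorphism
     already built. *)
  have [||||||h [h' hP]] := @cantor_space_extension _ _ _ (f i) (f' i \o d.1)
    (kX i.+1) (kX' i.+1) (cantor_space_is_compact (kX i)).
  - exact: embedding_continuous.
  - by case: (ef i).
  - by case: (nf i).
  - move=> x; apply: continuous_comp; first exact: ch.
    exact: embedding_continuous.
  - by apply: inj_comp (can_inj hK); case: (ef' i).
  - have [_ e0] := nf' i; rewrite -subset0 -e0; apply: interiorS.
    by move=> _ [x _ <-]; exists (d.1 x).
  - by exists (h, h').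
pose d := fix d i : D i :=
  if i is j.+1 then projT1 (cid (step j (d j))) else d0.
have dP i : mutual_homeo (d i).1 (d i).2.
  by elim: i => [|i IH] //=; have [] := projT2 (cid (step i (d i))) IH.
exists (fun i => (d i).1), (fun i => (d i).2); split=> // i.
by have [] := projT2 (cid (step i (d i))) (dP i).
Qed.

Theorem theorem3p3 (Y Z : topologicalType) :
  is_omega_cantor_space Y -> is_omega_cantor_space Z -> homeomorphic Y Z.
Proof.
move=> [X [f [g [kX ef nf lim_g]]]] [X' [f' [g' [kX' ef' nf' lim_g']]]].
have [h [h' [hh' hf]]] := cantor_towers_isomorphic kX kX' ef ef' nf nf'.
(* The inverses also commute with the bonding maps, so they induce the inverse map between the
   limits. *)
have h'f' i x : h' i.+1 (f' i x) = f i (h' i x).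
  have [_ _ _ h'K] := hh' i; have [_ _ hK _] := hh' i.+1.
  by rewrite -[x in LHS]h'K -hf hK.
have [|H cH HP] := direct_limit_map lim_g lim_g' _ hf.
  by move=> i; case: (hh' i).
have [|H' cH' H'P] := direct_limit_map lim_g' lim_g _ h'f'.
  by move=> i; case: (hh' i).
have [[_ _ gT _] [_ _ g'T _]] := (lim_g, lim_g').
exists H, H'; split=> // [y|z].
- have : [set: Y] y by []; rewrite -gT => -[i _ [x _ <-]].
  by have [_ _ hK _] := hh' i; rewrite HP H'P hK.
- have : [set: Z] z by []; rewrite -g'T => -[i _ [x _ <-]].
  by have [_ _ _ h'K] := hh' i; rewrite H'P HP h'K.
Qed.
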